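(* Let $G$ be a finite group and $S$ a union of conjugacy classes of $G$ with $1 \notin S$ and $S^{-1} = S$. Let $H$ be a subgroup of $G$ such that $\sum_{K} \frac{|K|\chi(K)}{d_\chi} \neq 0$ for every irreducible complex character $\chi$ of $G$ occurring as a constituent in the decomposition of $\lambda_G^H$ into irreducible characters, where $K$ runs over all conjugacy classes of $G$ contained in $S$. Then every total perfect code in $\mathrm{Cay}(G, S)$ intersects every left coset of $H$ in $G$ in exactly $|H|/|S|$ elements. In particular, if $|S|$ does not divide $|H|$, then $\mathrm{Cay}(G, S)$ has no total perfect code.
   Context: The Cayley graph $\mathrm{Cay}(G,S)$ has vertex set $G$, with $x, y$ adjacent iff $xy^{-1} \in S$. A total perfect code in a graph is a set $C$ of vertices such that every vertex is adjacent to exactly one vertex of $C$. For a character $\chi$, $d_\chi = \chi(1)$ is its degree, and $\chi(K)$ denotes $\chi(x)$ for any $x$ in the conjugacy class $K$. If $x_1H, \ldots, x_mH$ are the left cosets of $H$ in $G$ ($m = |G:H|$), $\lambda_G^H$ is the permutation representation of $G$ of degree $m$ on the space with basis $\{\delta_{x_1H}, \ldots, \delta_{x_mH}\}$ given by $\lambda_G^H(g)(\delta_{x_iH}) = \delta_{gx_iH}$ (the permutation representation of $G$ on the left cosets of $H$). *)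

(* Defs.v *)
From HB Require Import structures.
From mathcomp Require Import all_boot all_order all_algebra.
From mathcomp Require Import all_fingroup all_solvable all_field all_character.

Set Implicit Arguments.
Unset Strict Implicit.
Unset Printing Implicit Defensive.

Import GRing.Theory.
Local Open Scope ring_scope.

Definition cayley (gT : finGroupType) (S : {set gT}) : rel gT :=
  fun x y => (x * y^-1)%g \in S.

(* [e] is the adjacency relation of a graph with vertex set [V]. *)
Definition total_perfect_code (T : finType) (V : {set T}) (e : rel T)
    (C : {set T}) : Prop :=
  C \subset V /\ {in V, forall x, #|[set c in C | e x c]| = 1%N}.

Definition union_of_classes (gT : finGroupType) (G : {group gT})
    (S : {set gT}) : Prop :=
  exists2 P : {set {set gT}}, P \subset classes G & S = cover P.

Section CosetRepresentation.

Variables (gT : finGroupType) (G H : {group gT}).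

(* The index [i] stands for the basis vector of the i-th left coset. Column j
   of the matrix is the image of basis vector j, so the matrices act on column
   vectors; they still compose as [mx_repr] requires. *)
Definition lcoset_mx (g : gT) : 'M[algC]_#|lcosets H G| :=
  \matrix_(i, j) (enum_val i == g *: enum_val j :> {set gT})%g%:R.

Lemma lcoset_mx_repr : mx_repr G lcoset_mx.
Proof.
split=> [|g h Gg Gh]; apply/matrixP=> i j; rewrite !mxE.
  by rewrite mul1g (inj_eq enum_val_inj).
have hjP : (h *: enum_val j)%g \in lcosets H G.
  have /lcosetsP[x Gx ->] := enum_valP j.
  apply/lcosetsP; exists (h * x)%g; first exact: groupM.
  by rewrite mulgA mulg_set1.
rewrite (bigD1 (enum_rank_in hjP (h *: enum_val j)%g)) //= big1 => [|k ne_k].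
  by rewrite !mxE enum_rankK_in // eqxx mulr1 addr0 mulgA mulg_set1.
rewrite !mxE; case: eqP => [_|_]; last by rewrite mul0r.
case: eqP => [eq_k|_]; last by rewrite mulr0.
by case/eqP: ne_k; apply: enum_val_inj; rewrite enum_rankK_in.
Qed.

Definition lcoset_repr : mx_representation algC G #|lcosets H G| :=
  MxRepresentation lcoset_mx_repr.

End CosetRepresentation.

(* Main.v *)
Require Import Defs.
From mathcomp Require Import all_boot all_order all_algebra.
From mathcomp Require Import all_fingroup all_solvable all_field all_character.

Set Implicit Arguments.
Unset Strict Implicit.
Unset Printing Implicit Defensive.

Import GRing.Theory Num.Theory.
Local Open Scope ring_scope.

(** Double counting the pairs (x, c) with c in C, x in a left coset A of H and
    x c^-1 in S gives the linear system  sum_(s in S) |C :&: s^-1 A| = |H|,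
    whose matrix is the action of the sum of S on the functions on left cosets.
    As S is normalised by G, this matrix commutes with G, so by Schur's lemma
    it is a scalar on each simple submodule, namely one of the character sums
    that are assumed to be nonzero. Hence its kernel contains no simple
    submodule, and the constant |H|/|S| is the only solution of the system. *)

Section NormalSubset.

Variables (gT : finGroupType) (G : {group gT}) (S : {set gT}).

Lemma union_of_classes_subset : union_of_classes G S -> S \subset G.
Proof.
case=> P /subsetP sPG ->; apply/bigcupsP=> _ /sPG/imsetP[x Gx ->].
exact: class_subG.
Qed.

Lemma union_of_classes_norm : union_of_classes G S -> G \subset 'N(S)%g.
Proof.
case=> P /subsetP sPG ->; apply: norms_bigcup; apply/bigcapsP=> K.
by case/sPG/imsetP=> x _ ->; apply: class_norm.
Qed.

Lemma sum_normal_by_classes (R : nzRingType) (F : gT -> R) :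
    S \subset G -> G \subset 'N(S)%g ->
    {in G &, forall x y, F (x ^ y)%g = F x} ->
  \sum_(x in S) F x
    = \sum_(K in classes G | K \subset S) #|K|%:R * F (repr K).
Proof.
move=> sSG nSG FJ; pose FS x := if x \in S then F x else 0.
transitivity (\sum_(x in G) FS x).
  rewrite -big_mkcondr; apply: eq_bigl => x /=.
  by apply/idP/andP=> [Sx | []//]; rewrite (subsetP sSG).
rewrite sum_by_classes => [|x y Gx Gy]; last first.
  by rewrite /FS memJ_norm ?FJ ?(subsetP nSG).
rewrite [RHS]big_mkcondr; apply: eq_bigr => K /repr_classesP[_ defK].
rewrite /FS -(class_sub_norm _ nSG) -defK.
by case: ifP => _; rewrite ?mulr0.
Qed.

End NormalSubset.

Section SubsetSum.

Variables (F : fieldType) (gT : finGroupType) (G : {group gT}).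

Definition gset_op n (rG : mx_representation F G n) (S : {set gT}) : 'M_n :=
  \sum_(x in S) rG x.

Variables (n : nat) (rG : mx_representation F G n) (S : {set gT}).
Hypothesis sSG : S \subset G.

Lemma gset_op_centgmx : G \subset 'N(S)%g -> centgmx rG (gset_op rG S).
Proof.
move=> nSG; apply/centgmxP=> y Gy.
rewrite /gset_op [in RHS](reindex_acts 'J _ Gy) ?astabsJ //=.
rewrite mulmx_suml mulmx_sumr; apply: eq_bigr => x /(subsetP sSG) Gx.
by rewrite -!repr_mxM ?groupJ // -conjgC.
Qed.

Lemma val_submod_gset_op (U : 'M_n) (modU : mxmodule rG U) m
    (W : 'M_(m, \rank U)) :
  val_submod (W *m gset_op (submod_repr modU) S) = val_submod W *m gset_op rG S.
Proof.
rewrite !mulmx_sumr linear_sum; apply: eq_bigr => x /(subsetP sSG) Gx.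
exact: val_submodJ.
Qed.

End SubsetSum.

Lemma irr_constt_submod (gT : finGroupType) (G : {group gT}) n
    (rG : mx_representation algC G n) (U : 'M_n) (modU : mxmodule rG U)
    (i : Iirr G) :
  cfRepr (submod_repr modU) = 'chi_i -> i \in irr_constt (cfRepr rG).
Proof.
move=> chiU; apply/constt_charP; first exact: cfRepr_char.
exists (cfRepr (factmod_repr modU)); first exact: cfRepr_char.
apply/cfun_inP=> x Gx.
by rewrite -chiU !cfunE Gx !mulr1n -(mxtrace_sub_fact_mod modU).
Qed.

Section Schur.

Variables (gT : finGroupType) (G : {group gT}) (S : {set gT}).
Hypotheses (sSG : S \subset G) (nSG : G \subset 'N(S)%g).

Lemma gset_op_irr_scalar n (rG : mx_representation algC G n) :
    mx_irreducible rG ->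
  gset_op rG S = ((\sum_(x in S) cfRepr rG x) / cfRepr rG 1%g)%:M.
Proof.
move=> irrG.
have /is_scalar_mxP[e defS]: is_scalar_mx (gset_op rG S).
  exact: mx_abs_irr_cent_scalar (groupC irrG) _ (gset_op_centgmx _ sSG nSG).
have n_neq0: n%:R != 0 :> algC by rewrite pnatr_eq0 -lt0n; case/mx_irrP: irrG.
have trS: \tr (gset_op rG S) = \sum_(x in S) cfRepr rG x.
  rewrite raddf_sum; apply: eq_bigr => x /(subsetP sSG) Gx.
  by rewrite cfunE Gx.
by rewrite -trS cfRepr1 defS mxtrace_scalar -(mulr_natr e) mulfK.
Qed.

Variables (n : nat) (rG : mx_representation algC G n).

Lemma gset_op_mxsimple (U : 'M_n) :
    mxsimple rG U ->
  exists2 i, i \in irr_constt (cfRepr rG)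
    & U *m gset_op rG S = ((\sum_(x in S) 'chi_i x) / 'chi_i 1%g) *: U.
Proof.
move=> simU; have [modU _ _] := simU.
have irrU: mx_irreducible (submod_repr modU) by apply/submod_mx_irr.
have /irrP[i chi_i]: cfRepr (submod_repr modU) \in irr G.
  by apply/irr_reprP; exists (Representation (submod_repr modU)).
exists i; first exact: irr_constt_submod chi_i.
rewrite -{1}[U](in_submodK (submx_refl U)) -(val_submod_gset_op sSG modU).
by rewrite gset_op_irr_scalar // chi_i mul_mx_scalar linearZ /= in_submodK.
Qed.

Lemma gset_op_unitmx :
    {in irr_constt (cfRepr rG), forall i, \sum_(x in S) 'chi_i x != 0} ->
  gset_op rG S \in unitmx.
Proof.
move=> sum_neq0; rewrite -row_free_unit -kermx_eq0; apply: contraT => nzK.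
have modK := kermx_centg_module (gset_op_centgmx rG sSG nSG).
apply: (mxsimple_exists modK nzK) => -[U simU sUK].
have [i /sum_neq0 nz_i] := gset_op_mxsimple simU; have [_ nzU _] := simU.
move/sub_kermxP: sUK => -> /esym/eqP; rewrite scaler_eq0 (negPf nzU) orbF.
by rewrite mulf_eq0 invr_eq0 (negPf nz_i) (negPf (irr1_neq0 i)).
Qed.

End Schur.

Section CosetFunctions.

Variables (gT : finGroupType) (G H : {group gT}).

Lemma lcosets_translate (g : gT) (A : {set gT}) :
  g \in G -> A \in lcosets H G -> (g *: A)%g \in lcosets H G.
Proof.
move=> Gg /lcosetsP[x Gx ->]; apply/lcosetsP.
by exists (g * x)%g; rewrite ?groupM ?lcosetM.
Qed.

Lemma lcoset_repr_mul_col (g : gT) (f : {set gT} -> algC) :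
    g \in G ->
  lcoset_repr G H g *m \col_j f (enum_val j) = \col_i f (g^-1 *: enum_val i)%g.
Proof.
move=> Gg; apply/colP=> i; rewrite !mxE.
have lgi: (g^-1 *: enum_val i)%g \in lcosets H G.
  by rewrite lcosets_translate ?groupV ?enum_valP.
transitivity (\sum_(B in lcosets H G) (B == g^-1 *: enum_val i)%g%:R * f B).
  rewrite [RHS]big_enum_val; apply: eq_bigr => j _.
  rewrite !mxE; congr ((nat_of_bool _)%:R * _).
  by apply/eqP/eqP=> ->; rewrite -lcosetM ?mulgV ?mulVg lcoset1.
rewrite (bigD1 _ lgi) /= eqxx mul1r big1 ?addr0 // => B /andP[_ /negPf->].
exact: mul0r.
Qed.

Variable S : {set gT}.
Hypothesis sSG : S \subset G.
Hypothesis unitS : gset_op (lcoset_repr G H) S \in unitmx.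

Lemma sum_translates_eq0 (f : {set gT} -> algC) :
    {in lcosets H G, forall A, \sum_(s in S) f (s^-1 *: A)%g = 0} ->
  {in lcosets H G, forall A, f A = 0}.
Proof.
move=> sum_f A lA; pose v : 'cV_#|lcosets H G| := \col_j f (enum_val j).
suffices v0: v = 0.
  by have /colP/(_ (enum_rank_in lA A)) := v0; rewrite !mxE enum_rankK_in.
suffices Sv0: gset_op (lcoset_repr G H) S *m v = 0.
  by rewrite -(mulKmx unitS v) Sv0 mulmx0.
apply/colP=> i; rewrite mulmx_suml summxE [RHS]mxE.
apply: etrans (sum_f _ (enum_valP i)).
by apply: eq_bigr => s /(subsetP sSG) Gs; rewrite lcoset_repr_mul_col // mxE.
Qed.

Lemma sum_translates_const (f : {set gT} -> algC) (a : algC) :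
    {in lcosets H G, forall A, \sum_(s in S) f (s^-1 *: A)%g = a} ->
  {in lcosets H G, forall A, f A * #|S|%:R = a}.
Proof.
move=> sum_f A lA; apply/eqP; rewrite -subr_eq0; apply/eqP.
apply: (sum_translates_eq0 (f := fun B => f B * #|S|%:R - a)) lA => B lB.
by rewrite sumrB -mulr_suml sum_f // sumr_const mulr_natr subrr.
Qed.

End CosetFunctions.

Section TotalPerfectCodes.

Variables (gT : finGroupType) (G : {group gT}) (S : {set gT}).

Lemma card_cayley_neighbors (C : {set gT}) (x : gT) :
  #|[set c in C | cayley S x c]| = (\sum_(s in S) (s^-1 * x \in C)%g)%N.
Proof.
rewrite -sum1dep_card (reindex_inj (inj_comp (mulIg x) invg_inj)) /=.
rewrite -big_mkcondr; apply: eq_bigl => s.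
by rewrite /cayley invMg invgK mulKVg andbC.
Qed.

Lemma total_perfect_code_sum_translates (C A : {set gT}) :
    total_perfect_code G (cayley S) C -> A \subset G ->
  (\sum_(s in S) #|C :&: (s^-1 *: A)%g|)%N = #|A|.
Proof.
case=> _ codeC /subsetP sAG; rewrite -[RHS]sum1_card.
transitivity (\sum_(x in A) \sum_(s in S) (s^-1 * x \in C)%g)%N; last first.
  by apply: eq_bigr => x Ax; rewrite -card_cayley_neighbors codeC ?sAG.
rewrite exchange_big; apply: eq_bigr => s _ /=.
rewrite -sum1_card (reindex_inj (mulgI s^-1%g)) -big_mkcondr /=.
by apply: eq_bigl => x; rewrite inE mem_lcoset invgK mulKVg andbC.
Qed.

Lemma card_total_perfect_code_lcoset (H : {group gT}) (C : {set gT}) :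
    S \subset G -> H \subset G ->
    gset_op (lcoset_repr G H) S \in unitmx ->
    total_perfect_code G (cayley S) C ->
  {in lcosets H G, forall A, #|C :&: A| * #|S| = #|H|}%N.
Proof.
move=> sSG sHG unitS codeC A lA; apply/eqP.
rewrite -(eqr_nat algC) natrM; apply/eqP.
apply: (sum_translates_const sSG unitS (f := fun B => #|C :&: B|%:R)) lA.
move=> _ /lcosetsP[x Gx ->]; rewrite -natr_sum.
rewrite total_perfect_code_sum_translates ?card_lcoset //.
by rewrite -(lcoset_id Gx) mulgS.
Qed.

End TotalPerfectCodes.

Theorem theorem5p10 (gT : finGroupType) (G H : {group gT}) (S : {set gT})
    (S_classes : union_of_classes G S)
    (S_not1 : 1%g \notin S)
    (S_sym : (S^-1)%g = S)
    (sHG : H \subset G)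
    (sum_neq0 : forall i : Iirr G,
       i \in irr_constt (cfRepr (lcoset_repr G H)) ->
       \sum_(K in classes G | K \subset S)
          #|K|%:R * 'chi_i (repr K) / 'chi_i 1%g != 0) :
  (forall C : {set gT}, total_perfect_code G (cayley S) C ->
     forall A : {set gT}, A \in lcosets H G ->
       #|C :&: A|%:R = #|H|%:R / #|S|%:R :> rat)
  /\
  (~~ (#|S| %| #|H|)%N ->
     ~ exists C : {set gT}, total_perfect_code G (cayley S) C).
Proof.
have sSG := union_of_classes_subset S_classes.
have nSG := union_of_classes_norm S_classes.
have unitS: gset_op (lcoset_repr G H) S \in unitmx.
  apply: gset_op_unitmx => // i /sum_neq0; apply: contraNneq => sum0.
  rewrite -mulr_suml -sum_normal_by_classes ?sum0 ?mul0r // => x y _.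
  exact: cfunJ.
have cardH := card_total_perfect_code_lcoset sSG sHG unitS.
split=> [C codeC A lA | ndvd [C codeC]].
  have defH := cardH C codeC A lA; rewrite -defH natrM mulfK // pnatr_eq0.
  by apply: contraTneq (cardG_gt0 H) => S0; rewrite -defH S0 muln0.
have lH: (1 *: H)%g \in lcosets H G by rewrite mem_lcosets mulGSid ?group1.
by rewrite -(cardH C codeC _ lH) dvdn_mull in ndvd.
Qed.
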